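(* There exists $\varepsilon_0\in(0,1)$ such that for every $0<\varepsilon<\varepsilon_0$, every integer $\iota\ge 2$, every $\alpha\in(0,1)$ (rational or irrational) and every $\delta>0$, $$\left(U_\delta^{\iota-\varepsilon}\setminus U_\delta^{\iota}\right)\cap \Phi(\mathcal{F}_\alpha^{\omega})\neq\emptyset .$$
   Context: $\mathbb{T}=\mathbb{R}/\mathbb{Z}$; functions on $\mathbb{T}$ are identified with $1$-periodic functions on $\mathbb{R}$. $C^\omega$ means real-analytic. Norms: for an integer $k\ge 0$, $\|\phi\|_{C^k}=\sum_{i=0}^k\|\phi^{(i)}\|_\infty$; for $r=k+\theta$ with $k\ge0$ an integer and $\theta\in(0,1)$, $\|\phi\|_{C^r}=\sum_{i=0}^k\|\phi^{(i)}\|_\infty+[\phi^{(k)}]_\theta$, where $[\cdot]_\theta$ is the $\theta$-Hölder seminorm. For $r,\delta>0$, $U_\delta^r:=\{\phi\in C^\infty(\mathbb{T}) : \|\phi\|_{C^r}<\delta\}$. $D^\omega(\mathbb{T})$ is the set of orientation-preserving $C^\omega$ diffeomorphisms $f$ of $\mathbb{R}$ (with $C^\omega$ inverse) such that $f-\mathrm{Id}$ is $1$-periodic. The rotation number is $\rho(f)=\lim_{m\to\infty}(f^m(x)-x)/m\in\mathbb{R}$. $\mathcal{F}_\alpha^\omega:=\{f\in D^\omega(\mathbb{T}):\rho(f)=\alpha\}$. The map $\Phi$ is $\Phi(g):=\frac{g+g^{-1}}{2}-\mathrm{Id}$, where $g^{-1}$ is the inverse diffeomorphism; $\Phi(g)$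 is a $1$-periodic function. *)

(* Defs.v *)
From Stdlib Require Import Reals List Ensembles.
From Coquelicot Require Import Coquelicot.
Open Scope R_scope.

(* Functions on the circle R/Z are represented by 1-periodic functions on R. *)
Definition periodic (f : R -> R) : Prop := forall x : R, f (x + 1) = f x.

Definition smooth (f : R -> R) : Prop :=
  forall (n : nat) (x : R), ex_derive_n f n x.

Definition real_analytic (f : R -> R) : Prop :=
  forall x0 : R, exists (a : nat -> R) (r : R), 0 < r /\
    forall x : R, Rabs (x - x0) < r -> is_pseries a (x - x0) (f x).

(* The suprema take values in [Rbar], so that no finiteness is presupposed. *)
Definition sup_norm (f : R -> R) : Rbar :=
  Lub_Rbar (fun y => exists x : R, y = Rabs (f x)).

(* For 1-periodic functions the supremum over pairs of reals agrees with the
   supremum over pairs of points of R/Z with the quotient distance: a pair can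
   be translated to one at distance at most 1/2 with the same values. *)
Definition holder_seminorm (theta : R) (f : R -> R) : Rbar :=
  Lub_Rbar (fun y => exists s t : R,
    s <> t /\ y = Rabs (f s - f t) / Rpower (Rabs (s - t)) theta).

Definition Ck_norm (k : nat) (f : R -> R) : Rbar :=
  fold_right Rbar_plus (Finite 0)
    (map (fun i => sup_norm (Derive_n f i)) (seq 0 (S k))).

Definition Ck_theta_norm (k : nat) (theta : R) (f : R -> R) : Rbar :=
  Rbar_plus (Ck_norm k f) (holder_seminorm theta (Derive_n f k)).

(* Meaningful for [0 <= r] only: [Z.to_nat] truncates negative integer parts. *)
Definition Cr_norm (r : R) (f : R -> R) : Rbar :=
  let k := Z.to_nat (Int_part r) in
  if Req_EM_T (frac_part r) 0 then Ck_norm k f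
  else Ck_theta_norm k (frac_part r) f.

Definition U (r delta : R) : Ensemble (R -> R) :=
  fun phi => periodic phi /\ smooth phi /\ Rbar_lt (Cr_norm r phi) delta.

(* The inverse is carried as data; it is determined by [diffeo_map]. *)
Record analytic_circle_diffeo := {
  diffeo_map :> R -> R;
  diffeo_inv : R -> R;
  diffeo_mapK : forall x : R, diffeo_inv (diffeo_map x) = x;
  diffeo_invK : forall x : R, diffeo_map (diffeo_inv x) = x;
  diffeo_map_analytic : real_analytic diffeo_map;
  diffeo_inv_analytic : real_analytic diffeo_inv;
  diffeo_orientation : forall x y : R, x < y -> diffeo_map x < diffeo_map y;
  diffeo_periodic : periodic (fun x => diffeo_map x - x)
}.

(* The limit exists and is the same at every base point for each lift, so this
   relation is the graph of the rotation number; the term [m = 0] is irrelevant. *)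
Definition has_rotation_number (f : R -> R) (alpha : R) : Prop :=
  forall x : R, is_lim_seq (fun m => (Nat.iter m f x - x) / INR m) alpha.

Definition F (alpha : R) : Ensemble analytic_circle_diffeo :=
  fun f => has_rotation_number f alpha.

Definition Phi (g : analytic_circle_diffeo) : R -> R :=
  fun x => (g x + diffeo_inv g x) / 2 - x.

(* Main.v *)
(* Let [h y = (y + a sin y) / N] with [N = 2 PI n], let [kap] be its inverse, and
   let [g = h (kap + N alpha)], a conjugate of the rotation by [alpha].  As [sin]
   is an eigenvector of averaging over the translations by [N alpha] and
   [- N alpha], [Phi g] is exactly [(a / N) (cos (N alpha) - 1) sin kap].
   Since [kap' = N / (1 + a cos kap)], differentiation acts on the polynomials in
   [sin kap], [cos kap] and [1 / (1 + a cos kap)]; counting terms bounds the m-th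
   derivative of [sin kap] by [2 (32 N)^m m!], which yields both the analyticity
   of [g] and upper bounds for the norms of [Phi g].  Conversely [Phi g] has period
   [1/n], so by Rolle its C^iota norm is at least [n^iota] times its amplitude.
   The amplitude [delta / n^iota] therefore gives C^iota norm at least [delta]
   and C^(iota - eps) norm [O(n^(- eps))].  Along a suitable sequence of [n] the
   factor [1 - cos (N alpha)] stays away from 0, so that [a] is small. *)

Require Import Defs.
From Stdlib Require Import Reals ZArith Factorial Lra Lia List Ensembles Image.
From Coquelicot Require Import Coquelicot.
Open Scope R_scope.

(** * Polynomials over a family of functions, with degree and weight, under differentiation *)

(* [poly_in G d M f]: [f] is a polynomial in the generators [G] of degree at most
   [d] whose coefficients have absolute values summing to at most [M]. *)
Inductive poly_in (G : (R -> R) -> Prop) : nat -> R -> (R -> R) -> Prop :=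
| poly_gen f : G f -> poly_in G 1 1 f
| poly_const c : poly_in G 0 (Rabs c) (fun _ => c)
| poly_add d M1 M2 f g : poly_in G d M1 f -> poly_in G d M2 g ->
    poly_in G d (M1 + M2) (fun x => f x + g x)
| poly_mul d e M1 M2 f g : poly_in G d M1 f -> poly_in G e M2 g ->
    poly_in G (d + e) (M1 * M2) (fun x => f x * g x)
| poly_weak d e M1 M2 f g : (d <= e)%nat -> M1 <= M2 -> (forall x, f x = g x) ->
    poly_in G d M1 f -> poly_in G e M2 g.

Lemma poly_in_nonneg G d M f : poly_in G d M f -> 0 <= M.
Proof.
  induction 1; try lra.
  - apply Rabs_pos.
  - now apply Rmult_le_pos.
Qed.

Lemma poly_in_bound G B d M f : 1 <= B -> (forall g x, G g -> Rabs (g x) <= B) ->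
  poly_in G d M f -> forall x, Rabs (f x) <= M * B ^ d.
Proof.
  intros HB HG Hf x; induction Hf as [f Hf|c|d M1 M2 f g _ IHf _ IHg
    |d e M1 M2 f g _ IHf _ IHg|d e M1 M2 f g Hde HM Hfg Hf IHf].
  - rewrite pow_1, Rmult_1_l. now apply HG.
  - simpl; lra.
  - apply Rle_trans with (1 := Rabs_triang _ _). lra.
  - rewrite Rabs_mult, pow_add.
    replace (M1 * M2 * (B ^ d * B ^ e)) with ((M1 * B ^ d) * (M2 * B ^ e)) by ring.
    apply Rmult_le_compat; auto using Rabs_pos.
  - rewrite <- Hfg. apply Rle_trans with (1 := IHf).
    apply Rmult_le_compat; auto.
    + exact (poly_in_nonneg _ _ _ _ Hf).
    + apply pow_le; lra.
    + now apply Rle_pow.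
Qed.

(** By the product rule a monomial of degree [d] yields at most [d] terms, each with one generator
    replaced by its derivative, of degree [q + 1] and weight [L]. Hence the degree grows by [q] and
    the weight by the factor [L * d]. *)
Lemma poly_in_derive G q L d M f : 0 <= L ->
  (forall g, G g -> exists g', poly_in G (S q) L g' /\ forall x, is_derive g x (g' x)) ->
  poly_in G d M f ->
  exists f', poly_in G (d + q) (L * INR d * M) f' /\ forall x, is_derive f x (f' x).
Proof.
  intros HL HG Hf; induction Hf as [f Hf|c|d M1 M2 f g _ IHf _ IHg
    |d e M1 M2 f g Hf IHf Hg IHg|d e M1 M2 f g Hde HM Hfg Hf IHf].
  - destruct (HG f Hf) as [f' [H1 H2]]. exists f'; split; auto.
    refine (poly_weak _ _ _ _ _ _ _ _ _ (fun _ => eq_refl) H1); simpl; [lia|lra].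
  - exists (fun _ => 0); split.
    + refine (poly_weak _ _ _ _ _ _ _ _ _ (fun _ => eq_refl) (poly_const G 0)); [lia|].
      rewrite Rabs_R0; simpl; lra.
    + intros x; exact (is_derive_const c x).
  - destruct IHf as [f' [Hf1 Hf2]], IHg as [g' [Hg1 Hg2]].
    exists (fun x => f' x + g' x); split.
    + rewrite Rmult_plus_distr_l. now apply poly_add.
    + intros x; exact (is_derive_plus f g x _ _ (Hf2 x) (Hg2 x)).
  - destruct IHf as [f' [Hf1 Hf2]], IHg as [g' [Hg1 Hg2]].
    exists (fun x => f' x * g x + f x * g' x); split.
    + rewrite plus_INR.
      refine (poly_weak _ _ _ _ _ _ _ _ _ (fun _ => eq_refl)
               (poly_add _ (d + e + q) _ _ _ _ _ _)).
      * lia.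
      * apply Req_le. instantiate (1 := M1 * (L * INR e * M2)).
        instantiate (1 := (L * INR d * M1) * M2). ring.
      * refine (poly_weak _ _ _ _ _ _ _ _ _ (fun _ => eq_refl)
                 (poly_mul _ _ _ _ _ _ _ Hf1 Hg)); [lia|lra].
      * refine (poly_weak _ _ _ _ _ _ _ _ _ (fun _ => eq_refl)
                 (poly_mul _ _ _ _ _ _ _ Hf Hg1)); [lia|lra].
    + intros x; exact (is_derive_mult f g x _ _ (Hf2 x) (Hg2 x) Rmult_comm).
  - destruct IHf as [f' [Hf1 Hf2]]. exists f'; split.
    + refine (poly_weak _ _ _ _ _ _ _ _ _ (fun _ => eq_refl) Hf1); [lia|].
      apply Rmult_le_compat; auto.
      * apply Rmult_le_pos; auto using pos_INR.
      * exact (poly_in_nonneg _ _ _ _ Hf).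
      * apply Rmult_le_compat_l; auto. now apply le_INR.
    + intros x. apply is_derive_ext with (1 := Hfg); auto.
Qed.

(** After [j] differentiations the degree is [d + q * j], at most [(d + q) * (j + 1)]. The product
    of these bounds over [j < m] produces [fact m], the growth that analyticity allows. *)
Lemma poly_in_derive_n G q L d M f m : 0 <= L ->
  (forall g, G g -> exists g', poly_in G (S q) L g' /\ forall x, is_derive g x (g' x)) ->
  poly_in G d M f ->
  exists f', poly_in G (d + q * m) (M * (L * INR (d + q)) ^ m * INR (fact m)) f' /\
    forall x, is_derive_n f m x (f' x).
Proof.
  intros HL HG Hf; induction m as [|m [fm [IH1 IH2]]].
  - exists f; split; [|reflexivity].
    refine (poly_weak _ _ _ _ _ _ _ _ _ (fun _ => eq_refl) Hf); simpl; [lia|lra].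
  - destruct (poly_in_derive _ _ _ _ _ _ HL HG IH1) as [f' [H1 H2]].
    exists f'; split.
    + refine (poly_weak _ _ _ _ _ _ _ _ _ (fun _ => eq_refl) H1); [lia|].
      assert (HM := poly_in_nonneg _ _ _ _ IH1).
      apply Rle_trans with (L * (INR (d + q) * INR (S m)) *
        (M * (L * INR (d + q)) ^ m * INR (fact m))).
      * apply Rmult_le_compat_r; auto. apply Rmult_le_compat_l; auto.
        rewrite <- mult_INR. apply le_INR; nia.
      * rewrite fact_simpl, mult_INR, <- tech_pow_Rmult. apply Req_le; ring.
    + intros x; simpl.
      apply is_derive_ext with (2 := H2 x).
      intros t; symmetry; apply is_derive_n_unique; auto.
Qed.

(** * Real analyticity from factorial bounds on the derivatives *)

Lemma taylor_remainder f C rho x0 x n : smooth f ->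
  (forall m t, Rabs (Derive_n f (S m) t) <= C * rho ^ S m * INR (fact (S m))) ->
  Rabs (f x - sum_f_R0 (fun m => Derive_n f m x0 / INR (fact m) * (x - x0) ^ m) n)
    <= C * (rho * Rabs (x - x0)) ^ S n.
Proof.
  revert f x0 x.
  assert (Hlt : forall f x0 x, x0 < x -> smooth f ->
    (forall m t, Rabs (Derive_n f (S m) t) <= C * rho ^ S m * INR (fact (S m))) ->
    Rabs (f x - sum_f_R0 (fun m => Derive_n f m x0 / INR (fact m) * (x - x0) ^ m) n)
      <= C * (rho * Rabs (x - x0)) ^ S n).
  { intros f x0 x Hx Hf HC.
    destruct (Taylor_Lagrange f n x0 x Hx (fun t _ k _ => Hf k t)) as [z [_ Hz]].
    rewrite Hz at 1.
    rewrite (sum_eq _ (fun m => Derive_n f m x0 / INR (fact m) * (x - x0) ^ m)).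
    2: { intros i _; field. apply INR_fact_neq_0. }
    match goal with |- Rabs (?s + ?r - ?s) <= _ => replace (s + r - s) with r by ring end.
    rewrite Rabs_mult. unfold Rdiv.
    rewrite Rabs_mult, <- RPow_abs, Rpow_mult_distr.
    rewrite (Rabs_right (/ _)).
    2: { left; apply Rinv_0_lt_compat, INR_fact_lt_0. }
    replace (C * (rho ^ S n * Rabs (x - x0) ^ S n)) with
      (Rabs (x - x0) ^ S n * / INR (fact (S n)) * (C * rho ^ S n * INR (fact (S n)))).
    2: { field. apply INR_fact_neq_0. }
    apply Rmult_le_compat_l; auto.
    apply Rmult_le_pos; [apply pow_le, Rabs_pos|].
    left; apply Rinv_0_lt_compat, INR_fact_lt_0. }
  intros f x0 x Hf HC.
  (* The bound on the derivative of order [S n] forces the right side to be nonnegative, which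
     settles the case [x = x0]. *)
  assert (HC0 : 0 <= C * (rho * Rabs (x - x0)) ^ S n).
  { rewrite Rpow_mult_distr, <- Rmult_assoc. apply Rmult_le_pos.
    - apply Rmult_le_reg_r with (INR (fact (S n))); [apply INR_fact_lt_0|].
      rewrite Rmult_0_l. apply Rle_trans with (2 := HC n 0). apply Rabs_pos.
    - apply pow_le, Rabs_pos. }
  destruct (Rtotal_order x0 x) as [Hx|[<-|Hx]]; auto.
  - replace (sum_f_R0 _ n) with (f x0).
    + now rewrite Rminus_diag, Rabs_R0.
    + clear; induction n as [|n IH]; simpl; [field|].
      rewrite <- IH, Rminus_diag; ring.
  (* [Hlt] treats points to the right of [x0]; points to the left reduce to it by reflection, the
     signs of the derivatives and of the powers cancelling. *)
  - set (fo := fun t => f (- t)).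
    assert (HD : forall m t, Derive_n fo m t = (-1) ^ m * Derive_n f m (- t)).
    { intros m t; unfold fo. rewrite Derive_n_comp_opp; auto.
      exists (mkposreal 1 Rlt_0_1); auto. }
    assert (H := Hlt fo (- x0) (- x)).
    replace (f x) with (fo (- x)) by (unfold fo; now rewrite Ropp_involutive).
    rewrite (sum_eq _ (fun m => Derive_n fo m (- x0) / INR (fact m) * (- x - - x0) ^ m)).
    2: { intros i _. rewrite HD, Ropp_involutive.
         replace (- x - - x0) with (-1 * (x - x0)) by ring.
         rewrite Rpow_mult_distr.
         assert (Hs : (-1) ^ i * (-1) ^ i = 1).
         { rewrite <- Rpow_mult_distr. replace (-1 * -1) with 1 by ring. apply pow1. }
         transitivity (((-1) ^ i * (-1) ^ i) * (Derive_n f i x0 / INR (fact i) * (x - x0) ^ i)).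
         - rewrite Hs; ring.
         - unfold Rdiv; ring. }
    replace (Rabs (x - x0)) with (Rabs (- x - - x0)).
    2: { rewrite <- Rabs_Ropp. f_equal; ring. }
    apply H; [lra| |].
    + intros m t. apply ex_derive_n_comp_opp.
      exists (mkposreal 1 Rlt_0_1); auto.
    + intros m t. rewrite HD, Rabs_mult, pow_1_abs, Rmult_1_l; auto.
Qed.

(** The bound starts at order 1 so that it also covers the unbounded functions [x + c]. *)
Lemma analytic_of_derive_bound f C rho : 0 < rho -> smooth f ->
  (forall m t, Rabs (Derive_n f (S m) t) <= C * rho ^ S m * INR (fact (S m))) ->
  real_analytic f.
Proof.
  intros Hr Hf HC x0.
  (* At this radius [rho * Rabs (x - x0)] is at most 1/2, so the Taylor remainders decay
     geometrically. *)
  exists (fun m => Derive_n f m x0 / INR (fact m)), (/ (2 * rho)); split.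
  { apply Rinv_0_lt_compat; lra. }
  intros x Hx. apply is_pseries_R.
  assert (HC0 : 0 <= C).
  { apply Rmult_le_reg_r with (rho * 1); [lra|].
    rewrite Rmult_0_l. apply Rle_trans with (1 := Rabs_pos (Derive_n f 1 0)).
    apply Rle_trans with (1 := HC 0%nat 0); simpl; lra. }
  assert (Hq : rho * Rabs (x - x0) <= / 2).
  { apply Rle_trans with (rho * / (2 * rho)); [|right; field; lra].
    apply Rmult_le_compat_l; lra. }
  assert (Hlim : is_lim_seq (fun n => C * (/ 2) ^ S n) 0).
  { replace (Finite 0) with (Rbar_mult C 0) by (simpl; f_equal; ring).
    apply is_lim_seq_scal_l, (is_lim_seq_incr_1 (fun n => (/ 2) ^ n)).
    apply is_lim_seq_geom. rewrite Rabs_right; lra. }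
  set (u := sum_n (fun m => Derive_n f m x0 / INR (fact m) * (x - x0) ^ m)).
  change (is_lim_seq u (f x)).
  assert (Hu : forall n, Rabs (u n - f x) <= C * (/ 2) ^ S n).
  { intros n; unfold u. rewrite sum_n_Reals, Rabs_minus_sym.
    apply Rle_trans with (1 := taylor_remainder _ _ _ x0 x n Hf HC).
    apply Rmult_le_compat_l; auto. apply pow_incr; split; auto.
    apply Rmult_le_pos; [lra|apply Rabs_pos]. }
  apply is_lim_seq_ext with (fun n => (u n - f x) + f x); [intros n; ring|].
  replace (Finite (f x)) with (Finite (0 + f x)) by (f_equal; ring).
  apply is_lim_seq_plus'; [|apply is_lim_seq_const].
  apply is_lim_seq_abs_0.
  apply is_lim_seq_le_le with (u := fun _ => 0) (w := fun n => C * (/ 2) ^ S n); auto.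
  - intros n; split; auto using Rabs_pos.
  - apply is_lim_seq_const.
Qed.

Lemma real_analytic_plus f g :
  real_analytic f -> real_analytic g -> real_analytic (fun x => f x + g x).
Proof.
  intros Hf Hg x0.
  destruct (Hf x0) as [a [r [Hr Ha]]], (Hg x0) as [b [s [Hs Hb]]].
  exists (PS_plus a b), (Rmin r s); split; [now apply Rmin_glb_lt|].
  intros x Hx. apply (is_pseries_plus a b).
  - apply Ha. apply Rlt_le_trans with (1 := Hx), Rmin_l.
  - apply Hb. apply Rlt_le_trans with (1 := Hx), Rmin_r.
Qed.

Lemma real_analytic_ext f g :
  (forall x, f x = g x) -> real_analytic f -> real_analytic g.
Proof.
  intros Hfg Hf x0. destruct (Hf x0) as [a [r [Hr Ha]]].
  exists a, r; split; auto. intros x Hx; rewrite <- Hfg; auto.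
Qed.

Lemma real_analytic_translation c : real_analytic (fun x => x + c).
Proof.
  assert (H1 : forall x, is_derive_n (fun x => x + c) 1 x 1).
  { intros x; simpl. auto_derive; auto. }
  assert (H2 : forall m x, is_derive_n (fun x => x + c) (S (S m)) x 0).
  { induction m as [|m IH]; intros x.
    - apply (is_derive_ext (fun _ => 1)); [|exact (is_derive_const 1 x)].
      intros t; symmetry; apply is_derive_n_unique, H1.
    - apply (is_derive_ext (fun _ => 0)); [|exact (is_derive_const 0 x)].
      intros t; symmetry; apply is_derive_n_unique, IH. }
  apply analytic_of_derive_bound with 1 1; [lra| |].
  - intros [|[|m]] x; simpl; auto; eexists; [apply H1|apply H2].
  - intros [|m] t.
    + rewrite (is_derive_n_unique _ _ _ _ (H1 t)), Rabs_R1; simpl; lra.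
    + rewrite (is_derive_n_unique _ _ _ _ (H2 m t)), Rabs_R0, pow1.
      left; apply Rmult_lt_0_compat; [lra|apply INR_fact_lt_0].
Qed.

(** * The conjugating map and its inverse *)

(** Kepler's equation: [N * kepler N a y] is the mean anomaly belonging to the eccentric anomaly [y]
    at eccentricity [- a]. *)
Definition kepler (N a y : R) : R := (y + a * sin y) / N.

Lemma kepler_increasing N a y z : 0 < N -> 0 < a <= /4 ->
  y < z -> kepler N a y < kepler N a z.
Proof.
  intros HN Ha Hyz. unfold kepler. apply Rmult_lt_compat_r; [now apply Rinv_0_lt_compat|].
  destruct (MVT_cor2 sin cos y z Hyz (fun c _ => derivable_pt_lim_sin c)) as [c [Hc _]].
  assert (Hb := COS_bound c).
  assert (0 < (z - y) * (1 + a * cos c)) by (apply Rmult_lt_0_compat; nra).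
  assert (a * (sin z - sin y) = a * (cos c * (z - y))) by now rewrite Hc. lra.
Qed.

Lemma kepler_inverse N a : 0 < N -> 0 < a <= /4 ->
  exists kap : R -> R, (forall x, kepler N a (kap x) = x) /\ (forall y, kap (kepler N a y) = y).
Proof.
  intros HN Ha.
  assert (Hex : forall x, {y | kepler N a y = x}).
  { intros x.
    (* As [a * sin y] is less than 1 in absolute value, the root lies within 1 of [x * N]. *)
    destruct (IVT (fun y => y + a * sin y - x * N) (x * N - 1) (x * N + 1)) as [y [_ Hy]].
    - intros y. apply continuity_pt_filterlim, (ex_derive_continuous (fun y => y + a * sin y - x * N)).
      auto_derive; auto.
    - lra.
    - assert (H := SIN_bound (x * N - 1)); nra.
    - assert (H := SIN_bound (x * N + 1)); nra.
    - exists y. unfold kepler. apply Rmult_eq_reg_r with N; [|lra].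
      field_simplify; lra. }
  exists (fun x => proj1_sig (Hex x)); split.
  - intros x; exact (proj2_sig (Hex x)).
  - intros y. assert (H := proj2_sig (Hex (kepler N a y))); simpl in H.
    set (z := proj1_sig _) in *.
    destruct (Rtotal_order z y) as [Hz|[Hz|Hz]]; auto.
    + assert (H' := kepler_increasing N a _ _ HN Ha Hz). lra.
    + assert (H' := kepler_increasing N a _ _ HN Ha Hz). lra.
Qed.

(** The slope of [kepler] is at least [/ (2 * N)], because [1 + a * cos y] exceeds 1/2. The inverse
    is therefore Lipschitz with constant [2 * N], which its differentiation requires. *)
Lemma kepler_expansion N a y z : 0 < N -> 0 < a <= /4 ->
  Rabs (y - z) <= 2 * N * Rabs (kepler N a y - kepler N a z).
Proof.
  intros HN Ha. revert y z.
  assert (H : forall y z, y < z -> z - y <= 2 * N * (kepler N a z - kepler N a y)).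
  { intros y z Hyz. unfold kepler.
    destruct (MVT_cor2 sin cos y z Hyz (fun c _ => derivable_pt_lim_sin c)) as [c [Hc _]].
    assert (Hb := COS_bound c).
    replace (2 * N * _) with (2 * (z - y + a * (sin z - sin y))) by (field; lra).
    rewrite Hc.
    assert (0 <= (z - y) * (1 + 2 * (a * cos c))) by (apply Rmult_le_pos; nra). lra. }
  intros y z. destruct (Rtotal_order y z) as [Hz|[<-|Hz]].
  - assert (H' := kepler_increasing N a _ _ HN Ha Hz).
    rewrite !Rabs_left by lra. specialize (H _ _ Hz); lra.
  - rewrite !Rminus_diag, Rabs_R0; lra.
  - assert (H' := kepler_increasing N a _ _ HN Ha Hz).
    rewrite !Rabs_right by lra. specialize (H _ _ Hz); lra.
Qed.

Lemma kepler_inverse_derive N a kap : 0 < N -> 0 < a <= /4 ->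
  (forall x, kepler N a (kap x) = x) ->
  forall x, is_derive kap x (N * / (1 + a * cos (kap x))).
Proof.
  intros HN Ha Hk x. apply is_derive_Reals. intros eps He.
  assert (Hc := COS_bound (kap x)).
  set (D := (1 + a * cos (kap x)) / N).
  assert (HD : / (2 * N) <= D).
  { unfold D, Rdiv. rewrite Rinv_mult. apply Rmult_le_compat_r; [|nra].
    left; now apply Rinv_0_lt_compat. }
  assert (HN' : 0 < / (2 * N)) by (apply Rinv_0_lt_compat; lra).
  assert (Hd : derivable_pt_lim (kepler N a) (kap x) D).
  { apply is_derive_Reals. unfold kepler, D. auto_derive; auto. field; lra. }
  (* For the difference quotient [q] of [kepler], [/ q - / D] is [- (q - D) / (q * D)]. As [Rabs q]
     and [D] are at least [/ (2 * N)], an error below [eps / (2 * N) ^ 2] in [q] gives one below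
     [eps] in [/ q]. *)
  destruct (Hd (eps * / (2 * N) * / (2 * N))) as [d Hd'].
  { repeat apply Rmult_lt_0_compat; auto. }
  assert (Hdp := cond_pos d).
  assert (Hd2 : 0 < d / (2 * N)) by (apply Rdiv_lt_0_compat; lra).
  (* The inverse stretches increments by at most [2 * N], so this range of [t] keeps [u] within
     [d]. *)
  exists (mkposreal _ Hd2); simpl. intros t Ht Htd.
  set (u := kap (x + t) - kap x).
  assert (Hu : kepler N a (kap x + u) - kepler N a (kap x) = t).
  { unfold u. replace (kap x + (kap (x + t) - kap x)) with (kap (x + t)) by ring.
    rewrite !Hk; ring. }
  assert (Hu0 : u <> 0).
  { intros H; apply Ht. rewrite <- Hu, H, Rplus_0_r; ring. }
  assert (Hut : Rabs u <= 2 * N * Rabs t).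
  { unfold u. apply Rle_trans with (1 := kepler_expansion N a _ _ HN Ha).
    rewrite !Hk. replace (x + t - x) with t by ring. lra. }
  assert (Hud : Rabs u < d).
  { apply Rle_lt_trans with (1 := Hut).
    apply Rlt_le_trans with (2 * N * (d / (2 * N))); [|right; field; lra].
    apply Rmult_lt_compat_l; lra. }
  specialize (Hd' u Hu0 Hud). rewrite Hu in Hd'.
  set (q := t / u) in *.
  assert (Hq : / (2 * N) <= Rabs q).
  { unfold q, Rdiv. rewrite Rabs_mult, Rabs_inv.
    assert (0 < Rabs u) by now apply Rabs_pos_lt.
    apply Rmult_le_reg_r with (Rabs u); auto.
    rewrite Rmult_assoc, Rinv_l, Rmult_1_r by lra.
    apply Rmult_le_reg_l with (2 * N); [lra|].
    rewrite <- Rmult_assoc, Rinv_r; lra. }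
  replace (u / t) with (/ q) by (unfold q; field; auto).
  replace (N * / (1 + a * cos (kap x))) with (/ D).
  2: { unfold D. field. split; nra. }
  assert (Hq0 : q <> 0) by (intros H; rewrite H, Rabs_R0 in Hq; lra).
  replace (/ q - / D) with (- (q - D) * / q * / D) by (field; lra).
  rewrite !Rabs_mult, Rabs_Ropp, !Rabs_inv, (Rabs_right D) by lra.
  assert (Hq1 : / Rabs q <= 2 * N).
  { rewrite <- (Rinv_inv (2 * N)). now apply Rinv_le_contravar. }
  assert (HD1 : / D <= 2 * N).
  { rewrite <- (Rinv_inv (2 * N)). now apply Rinv_le_contravar. }
  apply Rle_lt_trans with (Rabs (q - D) * (2 * N) * (2 * N)).
  - assert (0 < / Rabs q) by (apply Rinv_0_lt_compat; lra).
    assert (0 < / D) by (apply Rinv_0_lt_compat; lra).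
    assert (Hp := Rabs_pos (q - D)).
    apply Rmult_le_compat; try lra.
    + apply Rmult_le_pos; lra.
    + apply Rmult_le_compat_l; lra.
  - apply Rlt_le_trans with (eps * / (2 * N) * / (2 * N) * (2 * N) * (2 * N)).
    + repeat apply Rmult_lt_compat_r; auto; lra.
    + right; field; lra.
Qed.

(** * Derivatives of trigonometric functions of the inverse *)

(** The reciprocal is included because [kap'] is [N] times it: the three functions then have
    derivatives that are polynomials in themselves, of degree at most 4 and weight at most [N]. *)
Inductive kepler_gen (a : R) (kap : R -> R) : (R -> R) -> Prop :=
| gen_sin : kepler_gen a kap (fun x => sin (kap x))
| gen_cos : kepler_gen a kap (fun x => cos (kap x))
| gen_inv : kepler_gen a kap (fun x => / (1 + a * cos (kap x))).

Lemma kepler_gen_bound a kap : 0 < a <= /4 ->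
  forall g x, kepler_gen a kap g -> Rabs (g x) <= 2.
Proof.
  intros Ha g x [].
  - assert (H := SIN_bound (kap x)). apply Rabs_le; lra.
  - assert (H := COS_bound (kap x)). apply Rabs_le; lra.
  - assert (H := COS_bound (kap x)).
    assert (/2 <= 1 + a * cos (kap x)) by nra.
    rewrite Rabs_inv, Rabs_right by lra.
    rewrite <- (Rinv_inv 2). apply Rinv_le_contravar; lra.
Qed.

Lemma kepler_gen_derive N a kap : 0 < N -> 0 < a <= /4 ->
  (forall x, is_derive kap x (N * / (1 + a * cos (kap x)))) ->
  forall g, kepler_gen a kap g ->
    exists g', poly_in (kepler_gen a kap) 4 N g' /\ forall x, is_derive g x (g' x).
Proof.
  intros HN Ha Hk g Hg.
  assert (Hc : forall x, 0 < 1 + a * cos (kap x)).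
  { intros x; assert (H := COS_bound (kap x)); nra. }
  assert (Ps := poly_gen _ _ (gen_sin a kap)).
  assert (Pc := poly_gen _ _ (gen_cos a kap)).
  assert (Pi := poly_gen _ _ (gen_inv a kap)).
  assert (Eq : forall x, Derive kap x = N * / (1 + a * cos (kap x))).
  { intros x; apply is_derive_unique, Hk. }
  assert (Hex : forall x, ex_derive kap x) by (intros x; eexists; apply Hk).
  destruct Hg.
  - eexists; split.
    + refine (poly_weak _ _ _ _ _ _ _ _ _ (fun _ => eq_refl)
        (poly_mul _ _ _ _ _ _ _ (poly_const _ N) (poly_mul _ _ _ _ _ _ _ Pc Pi))); [lia|].
      rewrite Rabs_right; lra.
    + intros x. simpl. auto_derive; auto. rewrite Eq; ring.
  - eexists; split.
    + refine (poly_weak _ _ _ _ _ _ _ _ _ (fun _ => eq_refl)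
        (poly_mul _ _ _ _ _ _ _ (poly_const _ (- N)) (poly_mul _ _ _ _ _ _ _ Ps Pi))); [lia|].
      rewrite Rabs_left; lra.
    + intros x. simpl. auto_derive; auto. rewrite Eq; ring.
  - eexists; split.
    + refine (poly_weak _ _ _ _ _ _ _ _ _ (fun _ => eq_refl)
        (poly_mul _ _ _ _ _ _ _ (poly_const _ (N * a)) (poly_mul _ _ _ _ _ _ _ Ps
          (poly_mul _ _ _ _ _ _ _ Pi (poly_mul _ _ _ _ _ _ _ Pi Pi))))); [lia|].
      rewrite Rabs_right; nra.
    + intros x. simpl. auto_derive.
      * split; auto. split; auto. specialize (Hc x); lra.
      * rewrite Eq. field. specialize (Hc x); lra.
Qed.

(** Here [q = 3], [L = N], the initial degree is 1 and the generators are bounded by 2. Each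
    differentiation contributes [N * 4] from the count of terms and [2 ^ 3] from the degree,
    together [32 * N]; the initial degree gives the leading 2. *)
Lemma kepler_derive_bound N a kap A B m : 0 < N -> 0 < a <= /4 ->
  (forall x, is_derive kap x (N * / (1 + a * cos (kap x)))) ->
  forall x, exists l, is_derive_n (fun x => A * sin (kap x) + B * cos (kap x)) m x l /\
    Rabs l <= 2 * (Rabs A + Rabs B) * (32 * N) ^ m * INR (fact m).
Proof.
  intros HN Ha Hk x.
  assert (Ps := poly_gen _ _ (gen_sin a kap)).
  assert (Pc := poly_gen _ _ (gen_cos a kap)).
  assert (Pf := poly_add _ _ _ _ _ _ (poly_mul _ _ _ _ _ _ _ (poly_const _ A) Ps)
    (poly_mul _ _ _ _ _ _ _ (poly_const _ B) Pc)).
  destruct (poly_in_derive_n _ 3 N _ _ _ m (Rlt_le _ _ HN)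
    (kepler_gen_derive N a kap HN Ha Hk) Pf) as [f' [H1 H2]].
  exists (f' x); split; auto.
  assert (H12 : 1 <= 2) by lra.
  apply Rle_trans with (1 := poly_in_bound _ 2 _ _ _ H12 (kepler_gen_bound a kap Ha) H1 x).
  right. rewrite pow_add, pow_mult.
  replace (32 * N) with ((N * 4) * 2 ^ 3) by ring. rewrite !Rpow_mult_distr.
  simpl (INR _). replace (1 + 1 + 1 + 1) with 4 by ring. simpl (2 ^ (0 + 1)). ring.
Qed.

Lemma kepler_smooth N a kap A B : 0 < N -> 0 < a <= /4 ->
  (forall x, is_derive kap x (N * / (1 + a * cos (kap x)))) ->
  smooth (fun x => A * sin (kap x) + B * cos (kap x)).
Proof.
  intros HN Ha Hk m x.
  destruct (kepler_derive_bound N a kap A B m HN Ha Hk x) as [l [Hl _]].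
  destruct m; simpl; auto. now exists l.
Qed.

(** * Conjugates of translations: analyticity, periodicity, rotation number *)

Lemma kepler_conjugate_analytic N a kap beta : 0 < N -> 0 < a <= /4 ->
  (forall x, kepler N a (kap x) = x) ->
  real_analytic (fun x => kepler N a (kap x + beta)).
Proof.
  intros HN Ha Hk.
  assert (Hd := kepler_inverse_derive N a kap HN Ha Hk).
  (* By the addition formula the conjugate is [x + beta / N] plus a combination of [sin (kap x)] and
     [cos (kap x)] with these coefficients. *)
  set (A := a / N * (cos beta - 1)). set (B := a / N * sin beta).
  apply real_analytic_ext with
    (fun x => (x + beta / N) + (A * sin (kap x) + B * cos (kap x))).
  { intros x. rewrite <- (Hk x) at 1. unfold kepler, A, B. rewrite sin_plus. field; lra. }
  apply real_analytic_plus; [apply real_analytic_translation|].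
  apply analytic_of_derive_bound with (2 * (Rabs A + Rabs B)) (32 * N); [lra| |].
  - exact (kepler_smooth N a kap A B HN Ha Hd).
  - intros m t.
    destruct (kepler_derive_bound N a kap A B (S m) HN Ha Hd t) as [l [Hl Hb]].
    now rewrite (is_derive_n_unique _ _ _ _ Hl).
Qed.

(** One turn in [y] is a step of [1 / n] in [x]. The case [m = n] makes the conjugates lifts of
    circle maps; the case [m = 1] gives the finer period of [Phi g]. *)
Lemma kepler_shift N n a y m : 0 < N -> N = 2 * PI * INR n ->
  kepler N a (y + 2 * INR m * PI) = kepler N a y + INR m / INR n.
Proof.
  intros HN Hn. unfold kepler. rewrite sin_period.
  assert (INR n <> 0) by (intros H; rewrite H in Hn; lra).
  rewrite Hn. field. split; auto. apply PI_neq0.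
Qed.

Lemma kepler_inverse_shift N n a kap x m : 0 < N -> N = 2 * PI * INR n ->
  (forall x, kepler N a (kap x) = x) -> (forall y, kap (kepler N a y) = y) ->
  kap (x + INR m / INR n) = kap x + 2 * INR m * PI.
Proof.
  intros HN Hn Hk1 Hk2. rewrite <- (Hk1 x) at 1.
  rewrite <- kepler_shift by auto. apply Hk2.
Qed.

Lemma kepler_conjugate_rotation_number N a kap beta alpha : 0 < N -> 0 < a <= /4 ->
  (forall x, kepler N a (kap x) = x) -> (forall y, kap (kepler N a y) = y) ->
  beta = N * alpha ->
  has_rotation_number (fun x => kepler N a (kap x + beta)) alpha.
Proof.
  intros HN Ha Hk1 Hk2 Hb x.
  set (g := fun x => kepler N a (kap x + beta)).
  assert (Hit : forall m, Nat.iter m g x = kepler N a (kap x + INR m * beta)).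
  { induction m as [|m IH].
    - simpl. now rewrite Rmult_0_l, Rplus_0_r, Hk1.
    - change (g (Nat.iter m g x) = kepler N a (kap x + INR (S m) * beta)).
      rewrite IH. unfold g. rewrite Hk2, S_INR. f_equal; ring. }
  (* The displacement after [m] steps is [m * alpha] plus this term, which is bounded by [/ N] since
     [2 * a <= 1]. *)
  set (e := fun m => / N * ((sin (kap x + INR m * beta) - sin (kap x)) * a)).
  apply is_lim_seq_ext_loc with (fun m => alpha + e m * / INR m).
  { exists 1%nat. intros m Hm. rewrite Hit.
    assert (0 < INR m) by (apply lt_0_INR; lia).
    rewrite <- (Hk1 x) at 2. unfold e, kepler. rewrite Hb. field; lra. }
  replace (Finite alpha) with (Finite (alpha + 0)) by (f_equal; ring).
  apply is_lim_seq_plus'; [apply is_lim_seq_const|].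
  assert (Hi : is_lim_seq (fun m => / N * / INR m) 0).
  { replace (Finite 0) with (Rbar_mult (/ N) 0) by (simpl; f_equal; ring).
    apply is_lim_seq_scal_l.
    replace (Finite 0) with (Rbar_inv p_infty) by reflexivity.
    apply is_lim_seq_inv; [apply is_lim_seq_INR|easy]. }
  apply is_lim_seq_abs_0.
  apply is_lim_seq_le_le_loc with (u := fun _ => 0) (w := fun m => / N * / INR m); auto.
  - exists 1%nat. intros m Hm; split; [apply Rabs_pos|].
    assert (Hm0 : 0 < INR m) by (apply lt_0_INR; lia).
    assert (0 < / N) by now apply Rinv_0_lt_compat.
    assert (0 < / INR m) by now apply Rinv_0_lt_compat.
    unfold e. rewrite !Rabs_mult, (Rabs_right (/ N)), (Rabs_right (/ INR m)) by lra.
    apply Rmult_le_compat_r; [lra|].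
    rewrite <- (Rmult_1_r (/ N)) at 2. apply Rmult_le_compat_l; [lra|].
    rewrite <- Rabs_mult.
    assert (H1 := SIN_bound (kap x)). assert (H2 := SIN_bound (kap x + INR m * beta)).
    apply Rabs_le; nra.
  - apply is_lim_seq_const.
Qed.

(** The inverse of the conjugate for [beta] is the conjugate for [- beta], and in their mean the
    terms with [sin beta] cancel. The summand [0 * cos (kap x)] keeps the shape to which
    [kepler_derive_bound] applies. *)
Lemma kepler_conjugate_diffeo n a alpha : (1 <= n)%nat -> 0 < a <= /4 ->
  let N := 2 * PI * INR n in
  exists (kap : R -> R) (g : analytic_circle_diffeo),
    (forall x, kepler N a (kap x) = x) /\ (forall y, kap (kepler N a y) = y) /\
    F alpha g /\
    forall x, a / N * (cos (N * alpha) - 1) * sin (kap x) + 0 * cos (kap x) = Phi g x.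
Proof.
  intros Hn Ha N.
  assert (Hn0 : 0 < INR n) by (apply lt_0_INR; lia).
  assert (HN : 0 < N) by (unfold N; assert (H := PI_RGT_0); nra).
  destruct (kepler_inverse N a HN Ha) as [kap [Hk1 Hk2]].
  assert (Hmono : forall x y, x < y -> kap x < kap y).
  { intros x y Hxy. rewrite <- (Hk1 x), <- (Hk1 y) in Hxy.
    destruct (Rtotal_order (kap x) (kap y)) as [H|[H|H]]; auto.
    - rewrite H in Hxy; lra.
    - assert (H' := kepler_increasing N a _ _ HN Ha H); lra. }
  set (g := fun beta x => kepler N a (kap x + beta)).
  assert (HgK : forall beta x, g (- beta) (g beta x) = x).
  { intros beta x; unfold g. rewrite Hk2.
    replace (kap x + beta + - beta) with (kap x) by ring. apply Hk1. }
  assert (HgK' : forall beta x, g beta (g (- beta) x) = x).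
  { intros beta x. rewrite <- (Ropp_involutive beta) at 1. apply HgK. }
  assert (Hor : forall beta x y, x < y -> g beta x < g beta y).
  { intros beta x y Hxy. apply kepler_increasing; auto.
    specialize (Hmono x y Hxy); lra. }
  assert (Hper : forall beta, periodic (fun x => g beta x - x)).
  { intros beta x. unfold g.
    replace (kap (x + 1)) with (kap x + 2 * INR n * PI).
    - replace (kap x + 2 * INR n * PI + beta) with (kap x + beta + 2 * INR n * PI) by ring.
      rewrite (kepler_shift N n) by auto. field; lra.
    - rewrite <- (kepler_inverse_shift N n a) by auto. f_equal; field; lra. }
  exists kap, (Build_analytic_circle_diffeo (g (N * alpha)) (g (- (N * alpha)))
    (HgK _) (HgK' _) (kepler_conjugate_analytic N a kap _ HN Ha Hk1)
    (kepler_conjugate_analytic N a kap _ HN Ha Hk1) (Hor _) (Hper _)).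
  repeat split; auto.
  - exact (kepler_conjugate_rotation_number N a kap _ alpha HN Ha Hk1 Hk2 eq_refl).
  - intros x. unfold Phi; simpl. rewrite <- (Hk1 x) at 5. unfold g, kepler.
    rewrite !sin_plus, sin_neg, cos_neg. field; lra.
Qed.

(** * Periodic functions: lower derivatives controlled by higher ones *)

Lemma derive_n_periodic f T k : (forall x, f (x + T) = f x) ->
  forall x, Derive_n f k (x + T) = Derive_n f k x.
Proof.
  intros HT x. rewrite <- Derive_n_comp_trans. now apply Derive_n_ext.
Qed.

Lemma mean_value_bound (f : R -> R) M : (forall x, ex_derive f x) ->
  (forall x, Rabs (Derive f x) <= M) ->
  forall x y, Rabs (f y - f x) <= M * Rabs (y - x).
Proof.
  intros Hf HM x y.
  destruct (MVT_gen f x y (Derive f)) as [c [_ ->]].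
  - intros t _; now apply Derive_correct.
  - intros t _. apply continuity_pt_filterlim, (ex_derive_continuous f), Hf.
  - rewrite Rabs_mult. apply Rmult_le_compat_r; auto using Rabs_pos.
Qed.

(* By Rolle, every derivative of positive order vanishes somewhere in each period. *)
Lemma periodic_derive_bound f T M k : 0 < T -> (forall x, f (x + T) = f x) -> smooth f ->
  (forall x, Rabs (Derive_n f (S k) x) <= M) ->
  forall x, Rabs (Derive_n f 1 x) <= T ^ k * M.
Proof.
  intros HT Hper Hf; revert M. induction k as [|k IH]; intros M HM x.
  - simpl. rewrite Rmult_1_l. apply HM.
  - replace (T ^ S k * M) with (T ^ k * (T * M)) by (simpl; ring).
    apply IH; clear x; intros x.
    destruct (MVT_gen (Derive_n f k) x (x + T) (Derive_n f (S k))) as [c [Hc1 Hc2]].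
    + intros t _. apply Derive_correct. exact (Hf (S k) t).
    + intros t _. apply continuity_pt_filterlim, (ex_derive_continuous (Derive_n f k)). exact (Hf (S k) t).
    + rewrite derive_n_periodic in Hc2 by auto.
      rewrite Rmin_left, Rmax_right in Hc1 by lra.
      assert (Hc : Derive_n f (S k) c = 0) by nra.
      assert (H := mean_value_bound (Derive_n f (S k)) M (Hf (S (S k))) HM c x).
      rewrite Hc, Rminus_0_r in H. apply Rle_trans with (1 := H).
      rewrite Rmult_comm. apply Rmult_le_compat_r.
      * apply Rle_trans with (2 := HM x), Rabs_pos.
      * apply Rabs_le; lra.
Qed.

(** * Estimates for the norms *)

Lemma sup_norm_ge f x : Rbar_le (Rabs (f x)) (sup_norm f).
Proof.
  apply (proj1 (Lub_Rbar_correct _)). now exists x.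
Qed.

Lemma sup_norm_le f (B : R) : (forall x, Rabs (f x) <= B) -> Rbar_le (sup_norm f) B.
Proof.
  intros H. apply (proj2 (Lub_Rbar_correct _)). intros y [x ->]; apply H.
Qed.

Lemma Ck_norm_ge k f i x : (i <= k)%nat -> Rbar_le (Rabs (Derive_n f i x)) (Ck_norm k f).
Proof.
  intros Hi. unfold Ck_norm.
  assert (Hin : List.In i (seq 0 (S k))) by (apply in_seq; lia).
  assert (Hpos : forall l, Rbar_le 0
    (fold_right Rbar_plus 0 (map (fun i => sup_norm (Derive_n f i)) l))).
  { induction l as [|j l IH]; [apply Rbar_le_refl|].
    cbn [map fold_right].
    replace (Finite 0) with (Rbar_plus 0 0) at 1 by (simpl; f_equal; ring).
    apply Rbar_plus_le_compat; auto.
    apply Rbar_le_trans with (2 := sup_norm_ge _ 0). apply Rabs_pos. }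
  induction (seq 0 (S k)) as [|j l IH]; [easy|].
  cbn [map fold_right]. destruct Hin as [->|Hin].
  - rewrite <- (Rbar_plus_0_r (Finite (Rabs _))).
    apply Rbar_plus_le_compat; auto. apply sup_norm_ge.
  - rewrite <- (Rbar_plus_0_l (Finite (Rabs _))).
    apply Rbar_plus_le_compat; auto.
    apply Rbar_le_trans with (2 := sup_norm_ge _ 0). apply Rabs_pos.
Qed.

Lemma Ck_norm_le k f (B : R) : (forall i x, (i <= k)%nat -> Rabs (Derive_n f i x) <= B) ->
  Rbar_le (Ck_norm k f) (INR (S k) * B).
Proof.
  intros H. unfold Ck_norm.
  rewrite <- (length_seq (S k) 0) at 2.
  assert (Hin : forall i, List.In i (seq 0 (S k)) -> (i <= k)%nat).
  { intros i Hi; apply in_seq in Hi; lia. }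
  induction (seq 0 (S k)) as [|j l IH].
  - simpl. lra.
  - cbn [map fold_right length]. rewrite S_INR.
    replace (Finite ((INR (length l) + 1) * B)) with (Rbar_plus B (INR (length l) * B))
      by (simpl; f_equal; ring).
    apply Rbar_plus_le_compat.
    + apply sup_norm_le. intros x; apply H, Hin; now left.
    + apply IH. intros i Hi; apply Hin; now right.
Qed.

Lemma Rpower_pos x y : 0 < Rpower x y.
Proof. apply exp_pos. Qed.

(** Interpolation at the scale [1 / N]: pairs at distance at least [1 / N] are handled by the sup
    bound, closer pairs by the Lipschitz bound. *)
Lemma holder_seminorm_le f theta B N : 0 < theta < 1 -> 1 <= N ->
  (forall x, Rabs (f x) <= B / N) -> (forall s t, Rabs (f s - f t) <= B * Rabs (s - t)) ->
  Rbar_le (holder_seminorm theta f) (2 * B * Rpower N (theta - 1)).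
Proof.
  intros Hth HN Hf HL. apply (proj2 (Lub_Rbar_correct _)).
  intros y [s [t [Hst ->]]].
  assert (Hd : 0 < Rabs (s - t)) by (apply Rabs_pos_lt; lra).
  specialize (HL s t). set (d := Rabs (s - t)) in *.
  assert (HB : 0 <= B / N) by (apply Rle_trans with (2 := Hf 0), Rabs_pos).
  assert (Hp := Rpower_pos d theta).
  apply Rmult_le_reg_r with (Rpower d theta); auto.
  unfold Rdiv. rewrite Rmult_assoc, Rinv_l, Rmult_1_r by lra.
  replace (2 * B * Rpower N (theta - 1) * Rpower d theta)
    with (B / N * (2 * Rpower (N * d) theta)).
  2: { rewrite <- Rpower_mult_distr by lra. unfold Rminus.
       rewrite Rpower_plus, Rpower_Ropp, Rpower_1 by lra. field; lra. }
  destruct (Rle_dec 1 (N * d)) as [H1|H1].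
  - apply Rle_trans with (B / N * 2).
    + apply Rle_trans with (Rabs (f s) + Rabs (- f t)); [apply Rabs_triang|].
      rewrite Rabs_Ropp. assert (H2 := Hf s). assert (H3 := Hf t). lra.
    + apply Rmult_le_compat_l; auto.
      assert (Rpower (N * d) 0 <= Rpower (N * d) theta) by (apply Rle_Rpower; lra).
      rewrite Rpower_O in H by lra. lra.
  - apply Rle_trans with (1 := HL).
    replace (B * d) with (B / N * (N * d)) by (field; lra).
    apply Rmult_le_compat_l; auto.
    assert (Hu : 0 < N * d) by nra.
    assert (N * d <= Rpower (N * d) theta).
    { unfold Rpower. rewrite <- (exp_ln (N * d)) at 1 by auto.
      assert (ln (N * d) < 0) by (rewrite <- ln_1; apply ln_increasing; lra).
      destruct (Req_dec (ln (N * d)) (theta * ln (N * d))) as [<-|He]; [lra|].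
      left; apply exp_increasing; nra. }
    lra.
Qed.

(** Each of the [k + 1] sup norms is at most [B / N <= B * Rpower N (- eps)], and the seminorm is at
    most twice the latter; hence the factor [k + 3]. *)
Lemma Ck_theta_norm_le k eps f B N : smooth f -> 0 < eps < 1 -> 1 <= N ->
  (forall i x, (i <= k)%nat -> Rabs (Derive_n f i x) <= B / N) ->
  (forall x, Rabs (Derive_n f (S k) x) <= B) ->
  Rbar_le (Ck_theta_norm k (1 - eps) f) (INR (k + 3) * B * Rpower N (- eps)).
Proof.
  intros Hf He HN H1 H2.
  assert (Hth : 0 < 1 - eps < 1) by lra.
  assert (HL := mean_value_bound _ _ (Hf (S k)) H2).
  assert (HB : 0 <= B) by (apply Rle_trans with (2 := H2 0), Rabs_pos).
  apply Rbar_le_trans with (Rbar_plus (INR (S k) * (B / N)) (2 * B * Rpower N (1 - eps - 1))).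
  - apply Rbar_plus_le_compat; [now apply Ck_norm_le|].
    apply holder_seminorm_le; auto.
  - simpl. replace (1 - eps - 1) with (- eps) by ring.
    rewrite plus_INR. change (INR 3) with (1 + 1 + 1).
    change (match k with 0%nat => 1 | S _ => INR k + 1 end) with (INR (S k)).
    rewrite S_INR.
    assert (/ N <= Rpower N (- eps)).
    { rewrite <- (Rpower_1 N) at 1 by lra. rewrite <- Rpower_Ropp. apply Rle_Rpower; lra. }
    assert (B * / N <= B * Rpower N (- eps)) by now apply Rmult_le_compat_l.
    assert (Hk := pos_INR k). unfold Rdiv.
    assert ((INR k + 1) * (B * / N) <= (INR k + 1) * (B * Rpower N (- eps)))
      by (apply Rmult_le_compat_l; lra).
    lra.
Qed.

Lemma Cr_norm_nat k f : Cr_norm (INR k) f = Ck_norm k f.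
Proof.
  unfold Cr_norm, frac_part. rewrite Int_part_INR, Nat2Z.id, <- INR_IZR_INZ, Rminus_diag.
  now destruct Req_EM_T.
Qed.

Lemma Cr_norm_frac k eps f : 0 < eps < 1 ->
  Cr_norm (INR (S k) - eps) f = Ck_theta_norm k (1 - eps) f.
Proof.
  intros He. unfold Cr_norm.
  destruct (Int_part_frac_part_spec (INR (S k) - eps) (Z.of_nat k) (1 - eps)) as [<- <-].
  - lra.
  - rewrite <- INR_IZR_INZ, S_INR; ring.
  - rewrite Nat2Z.id. destruct Req_EM_T; auto; lra.
Qed.

(** * Nonresonant frequencies *)

(* [sin (PI * alpha)] is a combination of the sines of [PI * n * alpha] and
   [PI * (n + 1) * alpha], so they cannot both be small. *)
Lemma exists_nonresonant n alpha :
  exists m, (n <= m)%nat /\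
    (sin (PI * alpha)) ^ 2 / 2 <= 1 - cos (2 * PI * INR m * alpha).
Proof.
  assert (Hcos : forall m, 1 - cos (2 * PI * INR m * alpha) = 2 * sin (PI * INR m * alpha) ^ 2).
  { intros m. replace (2 * PI * INR m * alpha) with (2 * (PI * INR m * alpha)) by ring.
    rewrite cos_2a_sin; ring. }
  set (s := sin (PI * alpha)).
  set (u := PI * INR n * alpha). set (v := PI * INR (S n) * alpha).
  assert (Hs : s = sin v * cos u - cos v * sin u).
  { unfold s. rewrite <- sin_minus. f_equal. unfold u, v. rewrite S_INR; ring. }
  assert (Hsq : s ^ 2 <= 2 * (sin u ^ 2 + sin v ^ 2)).
  { assert (Hu := COS_bound u). assert (Hv := COS_bound v).
    assert (cos u * cos u <= 1) by nra. assert (cos v * cos v <= 1) by nra.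
    assert (0 <= (sin v * cos u + cos v * sin u) ^ 2) by apply pow2_ge_0.
    assert (sin v ^ 2 * (cos u * cos u) <= sin v ^ 2 * 1)
      by (apply Rmult_le_compat_l; [apply pow2_ge_0|lra]).
    assert (sin u ^ 2 * (cos v * cos v) <= sin u ^ 2 * 1)
      by (apply Rmult_le_compat_l; [apply pow2_ge_0|lra]).
    rewrite Hs. lra. }
  destruct (Rle_dec (s ^ 2 / 4) (sin u ^ 2)) as [H|H].
  - exists n; split; auto. rewrite Hcos. fold u. lra.
  - exists (S n); split; auto. rewrite Hcos. fold v. lra.
Qed.

(** * Choice of frequency and amplitude, and comparison of the two norms *)

Theorem theorem1 :
  exists eps0 : R, 0 < eps0 < 1 /\
    forall (eps : R) (iota : nat) (alpha delta : R),
      0 < eps < eps0 -> (2 <= iota)%nat -> 0 < alpha < 1 -> 0 < delta ->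
      Inhabited (R -> R)
        (Intersection (R -> R)
          (Setminus (R -> R) (U (INR iota - eps) delta) (U (INR iota) delta))
          (Image.Im analytic_circle_diffeo (R -> R) (F alpha) Phi)).
Proof.
  (* Any value in (0,1) serves: the estimates only use [0 < eps < 1]. *)
  exists (/ 2); split; [lra|].
  intros eps iota alpha delta Heps Hiota Halpha Hdelta.
  destruct iota as [|k]; [lia|].
  assert (HPI := PI_RGT_0).
  set (s := sin (PI * alpha)).
  assert (Hs : 0 < s) by (apply sin_gt_0; nra).
  (* [K] dominates [(64 * PI) ^ m * fact m] for all [m <= S k]; the norm of exponent [S k - eps]
     will be at most [delta * K1 * n ^ (- eps)]. *)
  set (K := (64 * PI) ^ S k * INR (fact (S k))).
  set (K1 := INR (k + 3) * (2 * K)).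
  assert (HPI1 : 1 <= 64 * PI) by (assert (H := PI2_1); lra).
  assert (HK : 0 < K).
  { apply Rmult_lt_0_compat; [apply pow_lt; lra|apply INR_fact_lt_0]. }
  assert (HK1 : 0 < K1).
  { apply Rmult_lt_0_compat; [apply lt_0_INR; lia|lra]. }
  (* The three summands ensure in turn [1 <= n], [K1 < n ^ eps] and [a <= / 4]. *)
  destruct (INR_unbounded (1 + Rpower K1 (/ eps) + 16 * PI * delta / s ^ 2)) as [n0 Hn0].
  destruct (exists_nonresonant n0 alpha) as [n [Hn Hres]]. fold s in Hres.
  assert (Hs2 : 0 < s ^ 2) by now apply pow_lt.
  assert (HnR : INR n0 <= INR n) by now apply le_INR.
  assert (Hq1 := Rpower_pos K1 (/ eps)).
  assert (Hq2 : 0 < 16 * PI * delta / s ^ 2).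
  { apply Rdiv_lt_0_compat; auto. apply Rmult_lt_0_compat; lra. }
  set (N := 2 * PI * INR n).
  set (c := 1 - cos (N * alpha)). fold N c in Hres.
  assert (Hn1 : 1 <= INR n) by lra.
  assert (HN : 0 < N) by (unfold N; nra).
  assert (Hpk : 0 < INR n ^ k) by (apply pow_lt; lra).
  (* This solves [a / N * c = delta / n ^ S k], the amplitude wanted for [Phi g]. *)
  set (a := 2 * PI * delta / (INR n ^ k * c)).
  assert (Hc : 0 < c) by lra.
  assert (Hkc : 0 < INR n ^ k * c) by now apply Rmult_lt_0_compat.
  assert (Ha : 0 < a <= / 4).
  { split.
    - apply Rdiv_lt_0_compat; auto. apply Rmult_lt_0_compat; lra.
    - apply Rmult_le_reg_r with (4 * (INR n ^ k * c)); [lra|].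
      unfold a. replace (2 * PI * delta / _ * _) with (8 * PI * delta) by (field; lra).
      (* Here [2 <= iota] enters: it gives [n <= n ^ k], so that [a] is at most
         [4 * PI * delta / (n * s ^ 2)]. *)
      destruct k as [|k]; [lia|].
      assert (1 <= INR n ^ k) by now apply pow_R1_Rle.
      assert (INR n <= INR n ^ S k) by (simpl; nra).
      assert (16 * PI * delta <= s ^ 2 * INR n).
      { apply Rmult_le_reg_r with (/ s ^ 2); [now apply Rinv_0_lt_compat|].
        replace (s ^ 2 * INR n * / s ^ 2) with (INR n) by (field; lra).
        unfold Rdiv in Hn0. lra. }
      assert (s ^ 2 / 2 * INR n <= c * INR n ^ S k) by (apply Rmult_le_compat; lra).
      lra. }
  destruct (kepler_conjugate_diffeo n a alpha) as [kap [g [Hk1 [Hk2 [HF HPhi]]]]]; auto.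
  { apply INR_le. simpl; lra. }
  fold N in Hk1, Hk2, HPhi.
  assert (Hkd := kepler_inverse_derive N a kap HN Ha Hk1).
  set (amp := delta / INR n ^ S k).
  assert (Hamp0 : 0 < amp) by (apply Rdiv_lt_0_compat; auto; apply pow_lt; lra).
  set (A := a / N * (cos (N * alpha) - 1)) in *.
  assert (HA : A = - amp).
  { replace A with (- (a / N * c)) by (unfold A, c; ring).
    unfold amp, a, N. simpl. field. lra. }
  set (phi := fun x => A * sin (kap x) + 0 * cos (kap x)) in HPhi.
  assert (Hphi_smooth : smooth phi) by exact (kepler_smooth N a kap A 0 HN Ha Hkd).
  assert (HD : forall m x, Derive_n phi m x = Derive_n (Phi g) m x).
  { intros m x; now apply Derive_n_ext. }
  assert (Hsmooth : smooth (Phi g)).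
  { intros m x. apply ex_derive_n_ext with (1 := HPhi), Hphi_smooth. }
  assert (HperT : forall x, Phi g (x + / INR n) = Phi g x).
  { intros x. rewrite <- !HPhi. unfold phi.
    replace (/ INR n) with (INR 1 / INR n) by (simpl; field; lra).
    rewrite (kepler_inverse_shift N n a) by auto. now rewrite sin_period, cos_period. }
  assert (Hper : periodic (Phi g)).
  { intros x. rewrite <- !HPhi. unfold phi.
    replace 1 with (INR n / INR n) by (field; lra).
    rewrite (kepler_inverse_shift N n a) by auto. now rewrite sin_period, cos_period. }
  (* Differentiating [m] times costs [n ^ m] against the amplitude [delta / n ^ S k], so each order
     short of [S k] gains a factor [1 / n]. *)
  assert (Hup : forall m x, (m <= S k)%nat ->
    Rabs (Derive_n (Phi g) m x) <= 2 * delta * K / INR n ^ (S k - m)).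
  { intros m x Hm. rewrite <- HD.
    destruct (kepler_derive_bound N a kap A 0 m HN Ha Hkd x) as [l [Hl Hb]].
    unfold phi. rewrite (is_derive_n_unique _ _ _ _ Hl). apply Rle_trans with (1 := Hb).
    rewrite HA, Rabs_Ropp, Rabs_R0, Rabs_right, Rplus_0_r by lra.
    replace (32 * N) with ((64 * PI) * INR n) by (unfold N; ring).
    rewrite Rpow_mult_distr. unfold amp.
    assert (0 < INR n ^ m) by (apply pow_lt; lra).
    assert (Hp : 0 < INR n ^ (S k - m)) by (apply pow_lt; lra).
    replace (INR n ^ S k) with (INR n ^ (S k - m) * INR n ^ m)
      by (rewrite <- pow_add; f_equal; lia).
    replace (2 * (delta / (INR n ^ (S k - m) * INR n ^ m)) * ((64 * PI) ^ m * INR n ^ m)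
      * INR (fact m)) with (2 * delta * ((64 * PI) ^ m * INR (fact m)) / INR n ^ (S k - m))
      by (field; lra).
    apply Rmult_le_compat_r; [left; now apply Rinv_0_lt_compat|].
    apply Rmult_le_compat_l; [lra|].
    apply Rmult_le_compat.
    - apply pow_le; lra.
    - apply pos_INR.
    - now apply Rle_pow.
    - apply le_INR, fact_le, Hm. }
  exists (Phi g). constructor; [|now apply Im_intro with g].
  split.
  - repeat split; auto.
    rewrite Cr_norm_frac by lra.
    apply Rbar_le_lt_trans with (INR (k + 3) * (2 * delta * K) * Rpower (INR n) (- eps)).
    + apply Ck_theta_norm_le; auto; [lra| |].
      * intros i x Hi. apply Rle_trans with (1 := Hup i x ltac:(lia)).
        apply Rmult_le_compat_l; [nra|].
        apply Rinv_le_contravar; [lra|].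
        rewrite <- (pow_1 (INR n)) at 1. apply Rle_pow; [lra|lia].
      * intros x. apply Rle_trans with (1 := Hup (S k) x (le_n _)).
        rewrite Nat.sub_diag; simpl; lra.
    + simpl. rewrite Rpower_Ropp.
      assert (Hlt : K1 < Rpower (INR n) eps).
      { rewrite <- (Rpower_1 K1) by auto.
        replace 1 with (/ eps * eps) by (field; lra).
        rewrite <- Rpower_mult. unfold Rpower at 1 3.
        apply exp_increasing, Rmult_lt_compat_l; [lra|].
        apply ln_increasing; lra. }
      replace (INR (k + 3) * (2 * delta * K)) with (delta * K1) by (unfold K1; ring).
      apply Rmult_lt_reg_r with (Rpower (INR n) eps); [lra|].
      rewrite Rmult_assoc, Rinv_l by lra. nra.
  - intros [_ [_ Hlt]]. rewrite Cr_norm_nat in Hlt.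
    assert (Hle := fun x => Ck_norm_ge (S k) (Phi g) (S k) x (le_n _)).
    (* Of the infinite values, [p_infty] contradicts [Hlt] and [m_infty] contradicts [Hle]. *)
    destruct (Ck_norm (S k) (Phi g)) as [M| |]; [|easy|exact (Hle 0)].
    simpl in Hlt.
    assert (HT : 0 < / INR n) by (apply Rinv_0_lt_compat; lra).
    assert (H1 := periodic_derive_bound (Phi g) (/ INR n) M k HT HperT Hsmooth Hle).
    (* Between these points [sin kap] goes from 0 to 1, so [Phi g] changes by its full amplitude
       over a distance of at most [1 / n]. *)
    assert (H2 := mean_value_bound (Phi g) _ (Hsmooth 1%nat) H1 0 (kepler N a (PI / 2))).
    assert (Hkap0 : kap 0 = 0).
    { rewrite <- (Hk2 0) at 2. f_equal. unfold kepler. rewrite sin_0. field; lra. }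
    rewrite <- !HPhi in H2. unfold phi in H2.
    rewrite Hk2, Hkap0, sin_0, sin_PI2, HA, Rminus_0_r in H2.
    replace (- amp * 1 + 0 * cos (PI / 2) - (- amp * 0 + 0 * cos 0)) with (- amp) in H2 by ring.
    rewrite Rabs_Ropp, (Rabs_right amp) in H2 by lra.
    assert (HM : 0 <= M) by (apply Rle_trans with (2 := Hle 0), Rabs_pos).
    assert (Hx : Rabs (kepler N a (PI / 2)) <= / INR n).
    { unfold kepler, N. rewrite sin_PI2, Rabs_right.
      - apply Rmult_le_reg_r with (2 * PI * INR n); [nra|].
        assert (H := PI2_1). field_simplify; lra.
      - left; apply Rdiv_lt_0_compat; nra. }
    assert (Hin : 0 < / INR n ^ k) by now apply Rinv_0_lt_compat.
    rewrite pow_inv in H2.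
    (* Rolle supplies [n ^ (- k)] and the distance one more [1 / n], which together match the
       denominator of [amp]; this leaves [delta <= M], against [M < delta]. *)
    assert (Hb : amp <= / INR n ^ k * M * / INR n).
    { apply Rle_trans with (1 := H2). apply Rmult_le_compat_l; nra. }
    replace (/ INR n ^ k * M * / INR n) with (M / INR n ^ S k) in Hb by (simpl; field; lra).
    unfold amp in Hb.
    assert (H : delta <= M).
    { apply Rmult_le_reg_r with (/ INR n ^ S k); auto.
      apply Rinv_0_lt_compat, pow_lt; lra. }
    lra.
Qed.
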